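(* Let $\mathbb{A},\mathbb{B}$ be categories such that $\mathbb{B}$ admits equalisers, let $\mathbf{G}=(G,\delta,\varepsilon)$ be a comonad on $\mathbb{A}$, and let $F:\mathbb{B}\to\mathbb{A}$ be a functor with right adjoint $R:\mathbb{A}\to\mathbb{B}$. Suppose there exists a functor $\overline F:\mathbb{B}\to\mathbb{A}^G$ with $U^G\overline F=F$. Then the following are equivalent: (a) $F$ is $\mathbf{G}$-Galois, i.e. $t_{\overline F}:\mathbf{G}'\to\mathbf{G}$ is an isomorphism; (b) the composite $\overline FR\xrightarrow{\eta_G\overline FR}\phi^GU^G\overline FR=\phi^GFR\xrightarrow{\phi^G\sigma}\phi^G$ is an isomorphism; (c) the functor $\overline F:\mathbb{B}\to\mathbb{A}^G$ restricts to an equivalence of categories $\mathbf{Inj}(F,\mathbb{B})\to\mathbf{Inj}(U^G,\mathbb{A}^G)$; (d) for any $(a,\theta_a)\in\mathbf{Inj}(U^G,\mathbb{A}^G)$, the $(a,\theta_a)$-component $\overline\varepsilon_{(a,\theta_a)}$ of the counit $\overline\varepsilon$ of the adjunction $\overline F\dashv\overline R$ is an isomorphism; (e) for any $a\in\mathbb{A}$, $\overline\varepsilon_{\phi^G(a)}=\overline\varepsilon_{(G(a),\delta_a)}$ is an isomorphism.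
   Context: $\mathbb{A}^G$ is the category of $\mathbf{G}$-comodules (Eilenberg–Moore coalgebras) $(a,\theta_a:a\to G(a))$, $U^G:\mathbb{A}^G\to\mathbb{A}$ is the forgetful functor, $\phi^G:\mathbb{A}\to\mathbb{A}^G$, $a\mapsto(G(a),\delta_a)$, is its right adjoint, and $\eta_G:1\to\phi^GU^G$ is the unit of $U^G\dashv\phi^G$. Denote by $\eta:1\to RF$ and $\sigma:FR\to1$ the unit and counit of $F\dashv R$. A functor $\overline F$ with $U^G\overline F=F$ has the form $\overline F(b)=(F(b),\alpha_b)$ for a natural transformation $\alpha:F\to GF$. Let $\mathbf{G}'=(FR,F\eta R,\sigma)$ be the comonad on $\mathbb{A}$ generated by $F\dashv R$; then $t_{\overline F}:=G\sigma\cdot\alpha R:FR\to GFR\to G$ is a morphism of comonads $\mathbf{G}'\to\mathbf{G}$. Since $\mathbb{B}$ has equalisers, $\overline F$ has a right adjoint $\overline R:\mathbb{A}^G\to\mathbb{B}$, where $\overline R(a,\theta_a)$ is the equaliser of $R(\theta_a)$ and $R((t_{\overline F})_a)\cdot\eta_{R(a)}$, both $R(a)\to RG(a)$. For a functor $P:\mathbb{X}\to\mathbb{Y}$, an object $x\in\mathbb{X}$ is $P$-injective if for all $f:x_1\to x_2$ and $g:x_1\to x$ in $\mathbb{X}$ with $P(f)$ a split monomorphism there is $h:x_2\to x$ with $hf=g$. $\mathbf{Inj}(P,\mathbb{X})$ is the full subcategory of $\mathbb{X}$ of $P$-injective objects. *)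

(* Defs.v *)
From Stdlib Require Import ProofIrrelevance.

Set Implicit Arguments.
Unset Strict Implicit.
Unset Printing Implicit Defensive.

Declare Scope cat_scope.
Delimit Scope cat_scope with cat.
Open Scope cat_scope.

Record Category : Type := MkCategory {
  obj :> Type;
  hom : obj -> obj -> Type;
  idm : forall x, hom x x;
  comp : forall x y z, hom y z -> hom x y -> hom x z;
  comp_idl : forall x y (f : hom x y), comp (idm y) f = f;
  comp_idr : forall x y (f : hom x y), comp f (idm x) = f;
  comp_assoc : forall x y z w (h : hom z w) (g : hom y z) (f : hom x y),
    comp h (comp g f) = comp (comp h g) f }.

Arguments hom {c} x y.
Arguments idm {c} x.
Arguments comp {c x y z} g f.

Notation "g ∘ f" := (comp g f) (at level 40, left associativity) : cat_scope.

Definition is_iso (C : Category) (x y : C) (f : hom x y) : Prop :=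
  exists g : hom y x, g ∘ f = idm x /\ f ∘ g = idm y.

Definition split_mono (C : Category) (x y : C) (f : hom x y) : Prop :=
  exists r : hom y x, r ∘ f = idm x.

Record Functor (C D : Category) : Type := MkFunctor {
  fobj :> C -> D;
  fmap : forall x y : C, hom x y -> hom (fobj x) (fobj y);
  fmap_id : forall x : C, fmap (idm x) = idm (fobj x);
  fmap_comp : forall (x y z : C) (g : hom y z) (f : hom x y),
    fmap (g ∘ f) = fmap g ∘ fmap f }.

Arguments fmap {C D} _ {x y} _.

Definition id_functor (C : Category) : Functor C C.
Proof.
  refine {| fobj := fun x : C => x; fmap := fun _ _ f => f |}; reflexivity.
Defined.

Definition comp_functor (C D E : Category) (G : Functor D E) (F : Functor C D) :
  Functor C E.
Proof.
  refine {| fobj := fun x => G (F x); fmap := fun _ _ f => fmap G (fmap F f) |}.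
  - abstract (intros; now rewrite !fmap_id).
  - abstract (intros; now rewrite !fmap_comp).
Defined.

Notation "G ○ F" := (comp_functor G F) (at level 40, left associativity) : cat_scope.

Record NatTrans (C D : Category) (F G : Functor C D) : Type := MkNatTrans {
  nt_app :> forall x : C, hom (F x) (G x);
  nt_nat : forall (x y : C) (f : hom x y),
    nt_app y ∘ fmap F f = fmap G f ∘ nt_app x }.

Definition is_nat_iso (C D : Category) (F G : Functor C D) (m : NatTrans F G) : Prop :=
  exists n : NatTrans G F,
    (forall x, n x ∘ m x = idm (F x)) /\ (forall x, m x ∘ n x = idm (G x)).

Definition id_nat (C D : Category) (F : Functor C D) : NatTrans F F.
Proof.
  refine {| nt_app := fun x => idm (F x) |}.
  abstract (intros; now rewrite comp_idl, comp_idr).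
Defined.

(* The identity transformation between two equal functors. *)
Definition eq_nat (C D : Category) (F F' : Functor C D) (e : F = F') : NatTrans F F' :=
  match e in _ = K return NatTrans F K with eq_refl => id_nat F end.

Definition is_equivalence (C D : Category) (F : Functor C D) : Prop :=
  exists (G : Functor D C)
         (m : NatTrans (id_functor C) (G ○ F))
         (n : NatTrans (F ○ G) (id_functor D)),
    is_nat_iso m /\ is_nat_iso n.

Record Adjunction (C D : Category) (L : Functor C D) (R : Functor D C) : Type :=
  MkAdjunction {
  adj_unit : NatTrans (id_functor C) (R ○ L);
  adj_counit : NatTrans (L ○ R) (id_functor D);
  triangle_l : forall x : C, adj_counit (L x) ∘ fmap L (adj_unit x) = idm (L x);
  triangle_r : forall y : D, fmap R (adj_counit y) ∘ adj_unit (R y) = idm (R y) }.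

(* The last field says that the factorisation is unique. *)
Record Equaliser (C : Category) (x y : C) (f g : hom x y) : Type := MkEqualiser {
  eq_obj : C;
  eq_arr : hom eq_obj x;
  eq_arr_eq : f ∘ eq_arr = g ∘ eq_arr;
  eq_fact : forall (z : C) (h : hom z x), f ∘ h = g ∘ h -> hom z eq_obj;
  eq_fact_arr : forall (z : C) (h : hom z x) (E : f ∘ h = g ∘ h),
    eq_arr ∘ eq_fact E = h;
  eq_fact_uniq : forall (z : C) (k k' : hom z eq_obj),
    eq_arr ∘ k = eq_arr ∘ k' -> k = k' }.

Arguments eq_fact {C x y f g} e {z h} E : rename.

(* A choice of an equaliser for every parallel pair. *)
Definition Equalisers (C : Category) : Type :=
  forall (x y : C) (f g : hom x y), Equaliser f g.

Definition full_subcategory (C : Category) (P : C -> Prop) : Category.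
Proof.
  refine {| obj := {x : C | P x};
            hom := fun x y => hom (proj1_sig x) (proj1_sig y);
            idm := fun x => idm (proj1_sig x);
            comp := fun _ _ _ g f => g ∘ f |}.
  - abstract (intros; apply comp_idl).
  - abstract (intros; apply comp_idr).
  - abstract (intros; apply comp_assoc).
Defined.

Definition restrict_functor (C D : Category) (F : Functor C D)
  (P : C -> Prop) (Q : D -> Prop) (H : forall x, P x -> Q (F x)) :
  Functor (full_subcategory P) (full_subcategory Q).
Proof.
  unshelve refine {| fobj := fun x : full_subcategory P =>
              exist Q (F (proj1_sig x)) (H _ (proj2_sig x))
                : full_subcategory Q;
            fmap := fun _ _ f => fmap F f |}.
  - abstract (intros x; exact (fmap_id F (proj1_sig x))).
  - abstract (intros x y z g f; exact (fmap_comp F g f)).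
Defined.

Definition restricts_to_equivalence (C D : Category) (F : Functor C D)
  (P : C -> Prop) (Q : D -> Prop) : Prop :=
  exists H : forall x, P x -> Q (F x), is_equivalence (restrict_functor H).

(* [x] is [P]-injective. *)
Definition injective_for (X Y : Category) (P : Functor X Y) (x : X) : Prop :=
  forall (x1 x2 : X) (f : hom x1 x2) (g : hom x1 x),
    split_mono (fmap P f) -> exists h : hom x2 x, h ∘ f = g.

Record Comonad (A : Category) : Type := MkComonad {
  cm_functor :> Functor A A;
  cm_delta : NatTrans cm_functor (cm_functor ○ cm_functor);
  cm_eps : NatTrans cm_functor (id_functor A);
  cm_counit_l : forall a : A, cm_eps (cm_functor a) ∘ cm_delta a = idm (cm_functor a);
  cm_counit_r : forall a : A, fmap cm_functor (cm_eps a) ∘ cm_delta a = idm (cm_functor a);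
  cm_coassoc : forall a : A,
    cm_delta (cm_functor a) ∘ cm_delta a = fmap cm_functor (cm_delta a) ∘ cm_delta a }.

Record ComonadMorphism (A : Category) (H G : Comonad A) : Type := MkComonadMorphism {
  cmm_nat :> NatTrans H G;
  cmm_eps : forall a : A, cm_eps G a ∘ cmm_nat a = cm_eps H a;
  cmm_delta : forall a : A,
    cm_delta G a ∘ cmm_nat a = fmap G (cmm_nat a) ∘ cmm_nat (H a) ∘ cm_delta H a }.

Definition is_comonad_iso (A : Category) (H G : Comonad A) (m : ComonadMorphism H G) :
  Prop :=
  exists n : ComonadMorphism G H,
    (forall a, n a ∘ m a = idm (H a)) /\ (forall a, m a ∘ n a = idm (G a)).

Definition adjunction_comonad (A B : Category) (F : Functor B A) (R : Functor A B)
  (adj : Adjunction F R) : Comonad A.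
Proof.
  unshelve refine {| cm_functor := F ○ R;
    cm_delta := {| nt_app := (fun a => fmap F (adj_unit adj (R a)))
                     : forall a, hom ((F ○ R) a) ((F ○ R ○ (F ○ R)) a) |};
    cm_eps := adj_counit adj |}.
  - abstract (intros x y f; simpl;
      rewrite <- !fmap_comp; f_equal;
      exact (nt_nat (adj_unit adj) (fmap R f))).
  - abstract (intros a; simpl; apply triangle_l).
  - abstract (intros a; simpl; rewrite <- fmap_comp;
      exact (eq_trans (f_equal (fmap F) (triangle_r adj a)) (fmap_id F (R a)))).
  - abstract (intros a; simpl;
      rewrite <- !fmap_comp; f_equal;
      exact (nt_nat (adj_unit adj) (adj_unit adj (R a)))).
Defined.

Section Comodules.
Context {A : Category}.

Record Comodule (G : Comonad A) : Type := MkComodule {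
  cmd_obj : A;
  cmd_theta : hom cmd_obj (G cmd_obj);
  cmd_eps : cm_eps G cmd_obj ∘ cmd_theta = idm cmd_obj;
  cmd_delta : cm_delta G cmd_obj ∘ cmd_theta = fmap G cmd_theta ∘ cmd_theta }.

Record ComoduleHom (G : Comonad A) (x y : Comodule G) : Type := MkComoduleHom {
  cmh_hom : hom (cmd_obj x) (cmd_obj y);
  cmh_theta : cmd_theta y ∘ cmh_hom = fmap G cmh_hom ∘ cmd_theta x }.

Lemma ComoduleHom_eq (G : Comonad A) (x y : Comodule G) (f g : ComoduleHom x y) :
  cmh_hom f = cmh_hom g -> f = g.
Proof.
  destruct f as [f Hf], g as [g Hg]; simpl; intros ->.
  f_equal; apply proof_irrelevance.
Qed.

Variable G : Comonad A.

Definition comodule_category : Category.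
Proof.
  unshelve refine {| obj := Comodule G;
    hom := @ComoduleHom G;
    idm := fun x => {| cmh_hom := idm (cmd_obj x) |};
    comp := fun x y z g f => {| cmh_hom := cmh_hom g ∘ cmh_hom f |} |}.
  - abstract (now rewrite fmap_id, comp_idl, comp_idr).
  - abstract (now rewrite comp_assoc, cmh_theta, <- comp_assoc, cmh_theta, comp_assoc, fmap_comp).
  - abstract (intros; apply ComoduleHom_eq, comp_idl).
  - abstract (intros; apply ComoduleHom_eq, comp_idr).
  - abstract (intros; apply ComoduleHom_eq, comp_assoc).
Defined.

Definition forget : Functor comodule_category A.
Proof.
  now refine {| fobj := (@cmd_obj G : comodule_category -> A);
            fmap := fun x y (f : @hom comodule_category x y) => cmh_hom f |}.
Defined.

Definition cofree_obj (a : A) : Comodule G :=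
  {| cmd_obj := G a; cmd_theta := cm_delta G a;
     cmd_eps := cm_counit_l G a; cmd_delta := cm_coassoc G a |}.

Definition cofree : Functor A comodule_category.
Proof.
  unshelve refine {| fobj := cofree_obj : A -> comodule_category;
    fmap := fun a b f =>
      (@MkComoduleHom G (cofree_obj a) (cofree_obj b) (fmap G f) _
        : @hom comodule_category (cofree_obj a) (cofree_obj b)) |}.
  - abstract (exact (nt_nat (cm_delta G) f)).
  - abstract (intros; apply ComoduleHom_eq, fmap_id).
  - abstract (intros; apply ComoduleHom_eq, fmap_comp).
Defined.

Definition cofree_adjunction : Adjunction forget cofree.
Proof.
  unshelve refine {|
    adj_unit := {| nt_app := (fun x =>
        @MkComoduleHom G x (cofree_obj (cmd_obj x)) (cmd_theta x) (cmd_delta x))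
      : forall x, hom (id_functor comodule_category x) ((cofree ○ forget) x) |};
    adj_counit := {| nt_app := (fun a => cm_eps G a)
      : forall a, hom ((forget ○ cofree) a) (id_functor A a) |} |}.
  - abstract (intros x y f; apply ComoduleHom_eq; exact (cmh_theta f)).
  - abstract (intros a b f; exact (nt_nat (cm_eps G) f)).
  - abstract (intros x; exact (cmd_eps x)).
  - abstract (intros a; apply ComoduleHom_eq; exact (cm_counit_r G a)).
Defined.

End Comodules.

Section Lifting.
Context {A B : Category} (G : Comonad A) (F : Functor B A) (R : Functor A B).
Variable adj : Adjunction F R.
Variable Fbar : Functor B (comodule_category G).
Variable HF : forget G ○ Fbar = F.

Local Notation sigma := (adj_counit adj).
Local Notation eta := (adj_unit adj).
Local Notation iota := (eq_nat HF).
Local Notation iotaV := (eq_nat (eq_sym HF)).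
Local Notation sigma_ a := (sigma a : hom (F (R a)) a).
Local Notation eta_ b := (eta b : hom b (R (F b))).
Local Notation iota_ b := (iota b : hom (cmd_obj (Fbar b)) (F b)).
Local Notation iotaV_ b := (iotaV b : hom (F b) (cmd_obj (Fbar b))).

Lemma sigma_nat (a b : A) (f : hom a b) :
  f ∘ sigma_ a = sigma_ b ∘ fmap F (fmap R f).
Proof. exact (eq_sym (nt_nat sigma f)). Qed.

Lemma eta_nat (b c : B) (f : hom b c) : eta_ c ∘ f = fmap R (fmap F f) ∘ eta_ b.
Proof. exact (nt_nat eta f). Qed.

Lemma sigma_eta (b : B) : sigma_ (F b) ∘ fmap F (eta_ b) = idm (F b).
Proof. exact (triangle_l adj b). Qed.

Lemma eta_sigma (a : A) : fmap R (sigma_ a) ∘ eta_ (R a) = idm (R a).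
Proof. exact (triangle_r adj a). Qed.

Lemma iota_nat (b c : B) (f : hom b c) :
  iota_ c ∘ cmh_hom (fmap Fbar f) = fmap F f ∘ iota_ b.
Proof. exact (nt_nat iota f). Qed.

Lemma iotaV_nat (b c : B) (f : hom b c) :
  iotaV_ c ∘ fmap F f = cmh_hom (fmap Fbar f) ∘ iotaV_ b.
Proof. exact (nt_nat iotaV f). Qed.

Lemma iota_iotaV (b : B) : iota_ b ∘ iotaV_ b = idm (F b).
Proof. destruct HF; apply comp_idl. Qed.

Lemma iotaV_iota (b : B) : iotaV_ b ∘ iota_ b = idm (cmd_obj (Fbar b)).
Proof. destruct HF; apply comp_idl. Qed.

(* The coaction of [Fbar b], moved along [forget G ○ Fbar = F]. *)
Definition lift_alpha : NatTrans F (G ○ F).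
Proof.
  refine {| nt_app := (fun b => fmap G (iota_ b) ∘ cmd_theta (Fbar b) ∘ iotaV_ b)
                      : forall b, hom (F b) ((G ○ F) b) |}.
  abstract (destruct HF; intros x y f; simpl;
    rewrite !comp_idr, !fmap_id, !comp_idl;
    exact (cmh_theta (fmap Fbar f))).
Defined.

Local Notation lift_alpha_ b := (lift_alpha b : hom (F b) (G (F b))).

Lemma lift_alpha_eq (b : B) :
  lift_alpha_ b = fmap G (iota_ b) ∘ cmd_theta (Fbar b) ∘ iotaV_ b.
Proof. reflexivity. Qed.

Lemma lift_alpha_eps (b : B) : cm_eps G (F b) ∘ lift_alpha b = idm (F b).
Proof.
  unfold lift_alpha; simpl; destruct HF; simpl.
  rewrite comp_idr, fmap_id, comp_idl.
  exact (cmd_eps (Fbar b)).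
Qed.

Lemma lift_alpha_delta (b : B) :
  cm_delta G (F b) ∘ lift_alpha b = fmap G (lift_alpha b) ∘ lift_alpha b.
Proof.
  unfold lift_alpha; simpl; destruct HF; simpl.
  rewrite !comp_idr, !fmap_id, !comp_idl.
  exact (cmd_delta (Fbar b)).
Qed.

Lemma lift_alpha_nat (b c : B) (f : hom b c) :
  lift_alpha_ c ∘ fmap F f = fmap G (fmap F f) ∘ lift_alpha_ b.
Proof. exact (nt_nat lift_alpha f). Qed.

Lemma lift_alpha_unit (b : B) :
  fmap G (sigma_ (F b)) ∘ lift_alpha_ (R (F b)) ∘ fmap F (eta_ b) = lift_alpha_ b.
Proof.
  now rewrite <- comp_assoc, lift_alpha_nat, comp_assoc, <- fmap_comp, sigma_eta,
    fmap_id, comp_idl.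
Qed.

(* The comonad morphism [t_Fbar = G σ · α R]. *)
Definition lift_t : ComonadMorphism (adjunction_comonad adj) G.
Proof.
  unshelve refine {| cmm_nat :=
    {| nt_app := (fun a => fmap G (sigma_ a) ∘ lift_alpha_ (R a))
         : forall a, hom (adjunction_comonad adj a) (G a) |} |}.
  - abstract (intros x y f;
      pose proof (nt_nat lift_alpha (fmap R f)) as Ha;
      pose proof (nt_nat sigma f) as Hs;
      cbn [adjunction_comonad cm_functor comp_functor id_functor fmap fobj] in *;
      rewrite <- comp_assoc, Ha, !comp_assoc, <- !fmap_comp; now f_equal; f_equal).
  - abstract (intros a;
      pose proof (nt_nat (cm_eps G) (sigma_ a)) as He;
      cbn [adjunction_comonad cm_functor cm_eps comp_functor id_functor fmap fobj nt_app] in *;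
      now rewrite comp_assoc, He, <- comp_assoc, lift_alpha_eps, comp_idr).
  - abstract (intros a;
      pose proof (nt_nat (cm_delta G) (sigma_ a)) as Hd;
      cbn [adjunction_comonad cm_functor cm_delta comp_functor id_functor fmap fobj nt_app] in *;
      rewrite comp_assoc, Hd, <- comp_assoc, lift_alpha_delta;
      refine (eq_trans _ (comp_assoc _ _ _));
      refine (eq_trans _ (eq_sym (f_equal (comp (fmap G (fmap G (sigma_ a) ∘ lift_alpha_ (R a))))
                                  (lift_alpha_unit (R a)))));
      now rewrite fmap_comp, comp_assoc).
Defined.

(* The composite [Fbar R -> φ U Fbar R = φ F R -> φ], whose middle equality of
   functors is carried out by [iota]. *)
Definition lift_cofree_map : NatTrans (Fbar ○ R) (cofree G).
Proof.
  refine {| nt_app := (fun a =>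
    fmap (cofree G) (sigma_ a) ∘
      (fmap (cofree G) (iota_ (R a)) ∘ adj_unit (cofree_adjunction G) (Fbar (R a))))
    : forall a, hom ((Fbar ○ R) a) (cofree G a) |}.
  abstract (intros x y f; apply ComoduleHom_eq; simpl;
    pose proof (nt_nat sigma f) as Hs;
    destruct HF; simpl in *;
    rewrite !fmap_id, !comp_idl, <- comp_assoc, cmh_theta, !comp_assoc, <- !fmap_comp;
    exact (f_equal (fun k => fmap G k ∘ _) Hs)).
Defined.

Local Notation t_ a := (lift_t a : hom (F (R a)) (G a)).

Lemma lift_t_nat (a b : A) (f : hom a b) :
  t_ b ∘ fmap F (fmap R f) = fmap G f ∘ t_ a.
Proof. exact (nt_nat lift_t f). Qed.

Lemma lift_t_eq (a : A) : t_ a = fmap G (sigma_ a) ∘ lift_alpha_ (R a).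
Proof. reflexivity. Qed.

Definition lift_Rt (a : A) : hom (R a) (R (G a)) :=
  fmap R (t_ a) ∘ eta_ (R a).

Lemma lift_Rt_nat (a b : A) (f : hom a b) :
  lift_Rt b ∘ fmap R f = fmap R (fmap G f) ∘ lift_Rt a.
Proof.
  unfold lift_Rt.
  now rewrite <- comp_assoc, eta_nat, !comp_assoc, <- !fmap_comp, lift_t_nat.
Qed.

Lemma lift_Rt_sigma (a : A) : sigma_ (G a) ∘ fmap F (lift_Rt a) = t_ a.
Proof.
  unfold lift_Rt.
  now rewrite fmap_comp, comp_assoc, <- sigma_nat, <- comp_assoc, sigma_eta, comp_idr.
Qed.

(* [Rbar (a, θ)] is the chosen equaliser of [R θ] and [lift_Rt a = R t_a · η_(R a)]. *)
Variable eqB : Equalisers B.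

Definition lift_equaliser (x : comodule_category G) :
  Equaliser (fmap R (cmd_theta x)) (lift_Rt (cmd_obj x)) :=
  eqB _ _.

Lemma lift_fmap_eq (x y : comodule_category G) (f : @hom (comodule_category G) x y) :
  fmap R (cmd_theta y) ∘ (fmap R (cmh_hom f) ∘ eq_arr (lift_equaliser x)) =
  lift_Rt (cmd_obj y) ∘ (fmap R (cmh_hom f) ∘ eq_arr (lift_equaliser x)).
Proof.
  rewrite !comp_assoc, <- fmap_comp, (cmh_theta f), lift_Rt_nat, fmap_comp.
  now rewrite <- comp_assoc, eq_arr_eq, comp_assoc.
Qed.

Definition lift_right_adjoint : Functor (comodule_category G) B.
Proof.
  unshelve refine {| fobj := fun x => eq_obj (lift_equaliser x);
    fmap := fun x y (f : @hom (comodule_category G) x y) =>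
      eq_fact (lift_equaliser y) (lift_fmap_eq f) |}.
  - abstract (intros x; apply eq_fact_uniq; rewrite eq_fact_arr;
      cbn [comodule_category idm cmh_hom];
      now rewrite fmap_id, comp_idl, comp_idr).
  - abstract (intros x y z g f; apply eq_fact_uniq;
      rewrite comp_assoc, !eq_fact_arr, <- comp_assoc, eq_fact_arr;
      cbn [comodule_category comp cmh_hom];
      now rewrite fmap_comp, comp_assoc).
Defined.

Local Notation arr_ x :=
  (eq_arr (lift_equaliser x) : hom (lift_right_adjoint x) (R (cmd_obj x))).

Lemma lift_fmap_arr (x y : comodule_category G) (f : hom x y) :
  arr_ y ∘ fmap lift_right_adjoint f = fmap R (cmh_hom f) ∘ arr_ x.
Proof. apply eq_fact_arr. Qed.

Lemma lift_arr_eq (x : comodule_category G) :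
  fmap R (cmd_theta x) ∘ arr_ x = lift_Rt (cmd_obj x) ∘ arr_ x.
Proof. exact (eq_arr_eq (lift_equaliser x)). Qed.

Lemma lift_arr_uniq (x : comodule_category G) (b : B) (k k' : hom b (lift_right_adjoint x)) :
  arr_ x ∘ k = arr_ x ∘ k' -> k = k'.
Proof. apply eq_fact_uniq. Qed.

Definition lift_counit_hom (x : comodule_category G) :
  hom (cmd_obj (Fbar (lift_right_adjoint x))) (cmd_obj x) :=
  sigma_ (cmd_obj x) ∘ fmap F (arr_ x) ∘ iota_ (lift_right_adjoint x).

Definition lift_unit_hom (b : B) : hom b (R (cmd_obj (Fbar b))) :=
  fmap R (iotaV_ b) ∘ eta_ b.

Lemma lift_theta_iota (b : B) :
  fmap G (iota_ b) ∘ cmd_theta (Fbar b) = lift_alpha_ b ∘ iota_ b.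
Proof.
  rewrite lift_alpha_eq.
  now rewrite <- comp_assoc, iotaV_iota, comp_idr.
Qed.

Lemma lift_theta_iotaV (b : B) :
  cmd_theta (Fbar b) ∘ iotaV_ b = fmap G (iotaV_ b) ∘ lift_alpha_ b.
Proof.
  rewrite lift_alpha_eq.
  now rewrite !comp_assoc, <- fmap_comp, iotaV_iota, fmap_id, comp_idl.
Qed.

Lemma lift_counit_theta (x : comodule_category G) :
  cmd_theta x ∘ lift_counit_hom x =
  fmap G (lift_counit_hom x) ∘ cmd_theta (Fbar (lift_right_adjoint x)).
Proof.
  unfold lift_counit_hom.
  rewrite (fmap_comp G), <- (comp_assoc _ (fmap G (iota_ _))), lift_theta_iota.
  rewrite !comp_assoc, fmap_comp; f_equal.
  rewrite sigma_nat, <- !comp_assoc, <- (fmap_comp F), lift_arr_eq, fmap_comp.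
  rewrite comp_assoc, lift_Rt_sigma, lift_t_eq.
  now rewrite <- comp_assoc, lift_alpha_nat.
Qed.

Lemma lift_unit_eq (b : B) :
  fmap R (cmd_theta (Fbar b)) ∘ lift_unit_hom b =
  lift_Rt (cmd_obj (Fbar b)) ∘ lift_unit_hom b.
Proof.
  unfold lift_unit_hom.
  rewrite !comp_assoc, lift_Rt_nat, <- fmap_comp, lift_theta_iotaV, fmap_comp.
  rewrite <- !comp_assoc; f_equal.
  rewrite <- (lift_alpha_unit b).
  rewrite <- lift_t_eq, fmap_comp, <- comp_assoc, <- eta_nat, comp_assoc.
  reflexivity.
Qed.

Lemma lift_counit_unit (x : comodule_category G) :
  fmap R (lift_counit_hom x) ∘ lift_unit_hom (lift_right_adjoint x) =
  arr_ x.
Proof.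
  unfold lift_counit_hom, lift_unit_hom.
  rewrite comp_assoc, <- fmap_comp, <- (comp_assoc _ (iota_ _)), iota_iotaV, comp_idr.
  now rewrite fmap_comp, <- comp_assoc, <- eta_nat, comp_assoc, eta_sigma, comp_idl.
Qed.

Definition lift_unit_app (b : B) : hom b (lift_right_adjoint (Fbar b)) :=
  eq_fact (lift_equaliser (Fbar b)) (lift_unit_eq b).

Definition lift_counit_app (x : comodule_category G) :
  @hom (comodule_category G) (Fbar (lift_right_adjoint x)) x :=
  MkComoduleHom (lift_counit_theta x).

Lemma lift_unit_arr (b : B) : arr_ (Fbar b) ∘ lift_unit_app b = lift_unit_hom b.
Proof. apply eq_fact_arr. Qed.

Lemma lift_unit_nat (b c : B) (f : hom b c) :
  lift_unit_app c ∘ f = fmap lift_right_adjoint (fmap Fbar f) ∘ lift_unit_app b.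
Proof.
  apply lift_arr_uniq.
  rewrite !comp_assoc, lift_unit_arr, lift_fmap_arr, <- (comp_assoc _ (arr_ _)), lift_unit_arr.
  unfold lift_unit_hom.
  now rewrite <- comp_assoc, eta_nat, !comp_assoc, <- !fmap_comp, iotaV_nat.
Qed.

Lemma lift_counit_nat (x y : comodule_category G) (f : hom x y) :
  lift_counit_app y ∘ fmap Fbar (fmap lift_right_adjoint f) = f ∘ lift_counit_app x.
Proof.
  apply ComoduleHom_eq; cbn [comodule_category comp cmh_hom lift_counit_app].
  unfold lift_counit_hom.
  rewrite <- (comp_assoc _ (iota_ _)), iota_nat, !comp_assoc; f_equal.
  rewrite sigma_nat, <- !comp_assoc, <- !(fmap_comp F); do 2 f_equal.
  apply lift_fmap_arr.
Qed.

Lemma lift_triangle_l (b : B) :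
  lift_counit_app (Fbar b) ∘ fmap Fbar (lift_unit_app b) = idm (Fbar b).
Proof.
  apply ComoduleHom_eq; cbn [comodule_category comp idm cmh_hom lift_counit_app].
  unfold lift_counit_hom.
  transitivity (sigma_ _ ∘ fmap F (arr_ (Fbar b) ∘ lift_unit_app b) ∘ iota_ b).
  { rewrite <- (comp_assoc _ (iota_ _)), iota_nat, fmap_comp, !comp_assoc.
    reflexivity. }
  rewrite lift_unit_arr; unfold lift_unit_hom.
  rewrite fmap_comp, comp_assoc, <- sigma_nat.
  now rewrite <- (comp_assoc (iotaV_ b)), sigma_eta, comp_idr, iotaV_iota.
Qed.

Lemma lift_triangle_r (x : comodule_category G) :
  fmap lift_right_adjoint (lift_counit_app x) ∘ lift_unit_app (lift_right_adjoint x) =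
  idm (lift_right_adjoint x).
Proof.
  apply lift_arr_uniq.
  rewrite comp_assoc, lift_fmap_arr, <- comp_assoc, lift_unit_arr.
  exact (eq_trans (lift_counit_unit x) (eq_sym (comp_idr _))).
Qed.

(* The adjunction [Fbar ⊣ Rbar]; its counit at [(a, θ)] is carried by
   [F E -> F R a -> a], where [E -> R a] is the equaliser defining [Rbar (a, θ)]. *)
Definition lift_adjunction : Adjunction Fbar lift_right_adjoint.
Proof.
  unshelve refine {|
    adj_unit := {| nt_app := (fun b =>
        eq_fact (lift_equaliser (Fbar b)) (lift_unit_eq b))
      : forall b, hom (id_functor B b) ((lift_right_adjoint ○ Fbar) b) |};
    adj_counit := {| nt_app := (fun x => MkComoduleHom (lift_counit_theta x))
      : forall x, hom ((Fbar ○ lift_right_adjoint) x)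
                      (id_functor (comodule_category G) x) |} |}.
  - exact lift_unit_nat.
  - exact lift_counit_nat.
  - exact lift_triangle_l.
  - exact lift_triangle_r.
Defined.

End Lifting.

(* Main.v *)
Require Import Defs.
From Stdlib Require Import IndefiniteDescription.

(** The functor [R] is, up to isomorphism, [Rbar ∘ cofree]: both are right
    adjoint to [forget ∘ Fbar = F].  Concretely [R y] is an equaliser of the pair
    defining [Rbar (cofree y)], with projection [R t_y · η] ([cofree_factor_iso]).
    Under this identification the counit of [Fbar ⊣ Rbar] at [cofree y] becomes
    the composite of (b) at [y] ([cofree_map_counit]), whose underlying morphism
    is [t_y] ([cofree_map_hom]).  As [forget] reflects isomorphisms, (a), (b) and
    (e) all say that the morphisms [t_y] are invertible.

    For the injectives, the point is that for any adjunction [L ⊣ R] the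
    [L]-injective objects are exactly the retracts of the objects [R a]
    ([right_adjoint_injective], [injective_retract]), and that a natural
    transformation which is invertible at an object is invertible at its retracts
    ([iso_at_retract]).  Applied to [forget ⊣ cofree] this carries (e) to (d).
    Applied to [F ⊣ R] as well, it shows that [Rbar] always preserves injectives,
    so that [Fbar ⊣ Rbar] can be compared with the restriction of [Fbar] to
    injectives.  An equivalence having a right adjoint has an invertible counit
    ([restriction_counit_iso]), so (c) gives (d); conversely, under (e), [Fbar (R a)] is
    isomorphic to [cofree a], so [Fbar] preserves injectives, and the unit is
    invertible at [Rbar (cofree a) ≅ R a], hence at every [F]-injective object. *)

Set Implicit Arguments.
Unset Strict Implicit.
Unset Printing Implicit Defensive.

(** * Isomorphisms and retracts *)

Section Isomorphisms.
Context {C D : Category}.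

Lemma iso_comp (x y z : C) (f : hom x y) (g : hom y z) :
  is_iso f -> is_iso g -> is_iso (g ∘ f).
Proof.
  intros [f' [Hf Hf']] [g' [Hg Hg']]; exists (f' ∘ g'); split.
  - now rewrite <- comp_assoc, (comp_assoc g'), Hg, comp_idl.
  - now rewrite <- comp_assoc, (comp_assoc f), Hf', comp_idl.
Qed.

Lemma iso_inverse (x y : C) (f : hom x y) (g : hom y x) :
  g ∘ f = idm x -> f ∘ g = idm y -> is_iso g.
Proof. intros H H'; now exists f. Qed.

Lemma right_inverse_of_iso (x y : C) (f : hom x y) (g : hom y x) :
  is_iso f -> f ∘ g = idm y -> is_iso g.
Proof.
  intros [f' [Hf Hf']] H; exists f; split; trivial.
  assert (E : g = f').
  { now rewrite <- (comp_idl g), <- Hf, <- comp_assoc, H, comp_idr. }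
  now rewrite E.
Qed.

Lemma iso_cancel_r (x y z : C) (f : hom x y) (g : hom y z) :
  is_iso f -> is_iso (g ∘ f) -> is_iso g.
Proof.
  intros [f' [Hf Hf']] H.
  assert (E : g = g ∘ f ∘ f') by now rewrite <- comp_assoc, Hf', comp_idr.
  rewrite E; apply iso_comp; trivial; now exists f.
Qed.

Lemma fmap_iso (P : Functor C D) (x y : C) (f : hom x y) :
  is_iso f -> is_iso (fmap P f).
Proof.
  intros [g [H H']]; exists (fmap P g).
  now rewrite <- !fmap_comp, H, H', !fmap_id.
Qed.

Definition retract (x y : C) : Prop :=
  exists (s : hom x y) (r : hom y x), r ∘ s = idm x.

Lemma retract_trans (x y z : C) : retract x y -> retract y z -> retract x z.
Proof.
  intros [s [r H]] [s' [r' H']]; exists (s' ∘ s), (r ∘ r').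
  now rewrite <- comp_assoc, (comp_assoc r'), H', comp_idl.
Qed.

Lemma iso_retract (x y : C) (f : hom x y) : is_iso f -> retract x y.
Proof. intros [g [H _]]; now exists f, g. Qed.

Lemma iso_retract_sym (x y : C) (f : hom x y) : is_iso f -> retract y x.
Proof. intros [g [_ H]]; now exists g, f. Qed.

Lemma iso_at_retract (P Q : Functor C D) (m : NatTrans P Q) (x y : C) :
  retract x y -> is_iso (m y) -> is_iso (m x).
Proof.
  intros [s [r H]] [n [Hn Hn']]; exists (fmap P r ∘ n ∘ fmap Q s); split.
  - rewrite <- !comp_assoc, <- nt_nat, (comp_assoc n), Hn, comp_idl.
    now rewrite <- fmap_comp, H, fmap_id.
  - rewrite !comp_assoc, nt_nat, <- (comp_assoc _ (m y)), Hn', comp_idr.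
    now rewrite <- fmap_comp, H, fmap_id.
Qed.

Lemma nat_iso_pointwise (P Q : Functor C D) (m : NatTrans P Q) :
  is_nat_iso m <-> forall x, is_iso (m x).
Proof.
  split.
  - intros [n [H H']] x; now exists (n x).
  - intros H.
    pose (n x := proj1_sig (constructive_indefinite_description _ (H x))).
    assert (Hn : forall x, n x ∘ m x = idm (P x) /\ m x ∘ n x = idm (Q x))
      by exact (fun x => proj2_sig (constructive_indefinite_description _ (H x))).
    unshelve eexists (@MkNatTrans _ _ Q P n _).
    + intros x y f.
      rewrite <- (comp_idr (n y ∘ _)), <- (proj2 (Hn x)).
      rewrite comp_assoc, <- (comp_assoc _ (fmap Q f)), <- nt_nat.
      now rewrite (comp_assoc (n y)), (proj1 (Hn y)), comp_idl.
    + split; intros x; apply Hn.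
Qed.

End Isomorphisms.

Lemma fmap_retract (C D : Category) (P : Functor C D) (x y : C) :
  retract x y -> retract (P x) (P y).
Proof.
  intros [s [r H]]; exists (fmap P s), (fmap P r).
  now rewrite <- fmap_comp, H, fmap_id.
Qed.

(** * Injectivity relative to a left adjoint *)

Lemma retract_injective (X Y : Category) (P : Functor X Y) (x y : X) :
  retract x y -> injective_for P y -> injective_for P x.
Proof.
  intros [s [r H]] Hy x1 x2 f g Hf.
  destruct (Hy x1 x2 f (s ∘ g) Hf) as [h Hh]; exists (r ∘ h).
  now rewrite <- comp_assoc, Hh, comp_assoc, H, comp_idl.
Qed.

Section AdjunctionInjectives.
Context {X Y : Category} {L : Functor X Y} {R : Functor Y X} (adj : Adjunction L R).

Local Notation eta x := (adj_unit adj x : hom x (R (L x))).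
Local Notation eps a := (adj_counit adj a : hom (L (R a)) a).

Lemma unit_natural (x y : X) (f : hom x y) :
  eta y ∘ f = fmap R (fmap L f) ∘ eta x.
Proof. exact (nt_nat (adj_unit adj) f). Qed.

(** Transposing [g] gives [L x1 -> a], which extends along the split
    monomorphism [L f] by composing with its retraction. *)
Lemma right_adjoint_injective (a : Y) : injective_for L (R a).
Proof.
  intros x1 x2 f g [r Hr].
  (* The transpose of [ε · L g · r : L x2 -> a]. *)
  exists (fmap R (eps a ∘ fmap L g ∘ r) ∘ eta x2).
  rewrite <- comp_assoc, unit_natural, comp_assoc, <- fmap_comp.
  rewrite <- (comp_assoc _ r), Hr, comp_idr, fmap_comp, <- comp_assoc.
  rewrite <- unit_natural, comp_assoc.
  exact (eq_trans (f_equal (fun k => k ∘ g) (triangle_r adj a)) (comp_idl g)).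
Qed.

(** By the triangle identity [L] makes the unit a split monomorphism, so the
    identity of an injective object extends along the unit. *)
Lemma injective_retract (x : X) : injective_for L x -> retract x (R (L x)).
Proof.
  intros Hx.
  destruct (Hx _ _ (adj_unit adj x) (idm x)) as [r Hr].
  - exists (adj_counit adj (L x)); apply triangle_l.
  - now exists (adj_unit adj x), r.
Qed.

Lemma unit_iso_of_counit (a : Y) :
  is_iso (adj_counit adj a) -> is_iso (adj_unit adj (R a)).
Proof.
  intros H.
  exact (right_inverse_of_iso (f := fmap R (eps a)) (fmap_iso R H) (triangle_r adj a)).
Qed.

End AdjunctionInjectives.

(** * Restricting an adjunction to an equivalence *)

Lemma equivalence_fully_faithful (C D : Category) (K : Functor C D) :
  is_equivalence K ->
  (forall (x y : C) (f g : hom x y), fmap K f = fmap K g -> f = g) /\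
  (forall (x y : C) (k : hom (K x) (K y)), exists f : hom x y, fmap K f = k).
Proof.
  intros [H [m [n [Hm Hn]]]].
  destruct Hm as [m' [Hm Hm']], Hn as [n' [Hn Hn']].
  assert (faithful : forall (x y : C) (f g : hom x y), fmap K f = fmap K g -> f = g).
  { intros x y f g E.
    pose proof (nt_nat m f) as Ef; pose proof (nt_nat m g) as Eg.
    cbn [id_functor comp_functor fmap fobj] in *.
    rewrite E, <- Eg in Ef.
    apply (f_equal (comp (m' y))) in Ef; rewrite !comp_assoc in Ef.
    rewrite Hm in Ef; exact (eq_trans (eq_sym (comp_idl f)) (eq_trans Ef (comp_idl g))). }
  (* The inverse equivalence is faithful by the same argument. *)
  assert (faithful' : forall (x y : D) (f g : hom x y), fmap H f = fmap H g -> f = g).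
  { intros x y f g E.
    pose proof (nt_nat n f) as Ef; pose proof (nt_nat n g) as Eg.
    cbn [id_functor comp_functor fmap fobj] in *.
    rewrite E, Eg in Ef.
    apply (f_equal (fun k => k ∘ n' x)) in Ef; rewrite <- !comp_assoc in Ef.
    rewrite Hn' in Ef.
    exact (eq_sym (eq_trans (eq_sym (comp_idr g)) (eq_trans Ef (comp_idr f)))). }
  split; trivial.
  intros x y k.
  (* Conjugating [H k] by [m] gives [f] with [H (K f) = H k]. *)
  exists (m' y ∘ (fmap H k : hom ((H ○ K) x) ((H ○ K) y)) ∘ m x).
  apply faithful'.
  set (f := m' y ∘ _ ∘ m x).
  pose proof (nt_nat m f) as Ef; cbn [id_functor comp_functor fmap fobj] in Ef.
  unfold f in Ef at 1.
  apply (f_equal (fun k => k ∘ m' x)) in Ef.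
  rewrite !comp_assoc, Hm', <- !comp_assoc, !Hm' in Ef.
  symmetry.
  refine (eq_trans _ (eq_trans Ef (comp_idr _))).
  exact (eq_sym (eq_trans (comp_idl _) (comp_idr _))).
Qed.

Section RestrictedAdjunction.
Context {C D : Category} {L : Functor C D} {R : Functor D C} (adj : Adjunction L R).

Local Notation eta x := (adj_unit adj x : hom x (R (L x))).

Variables (P : C -> Prop) (Q : D -> Prop).
Hypothesis R_preserves : forall y, Q y -> P (R y).

Lemma restriction_equivalence :
  (forall x, P x -> Q (L x)) ->
  (forall x, P x -> is_iso (adj_unit adj x)) ->
  (forall y, Q y -> is_iso (adj_counit adj y)) ->
  restricts_to_equivalence L P Q.
Proof.
  intros H Hunit Hcounit; exists H.
  unshelve eexists (restrict_functor R_preserves), _, _.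
  - unshelve eexists.
    + exact (fun x => adj_unit adj (proj1_sig x)).
    + intros x y f; exact (nt_nat (adj_unit adj) f).
  - unshelve eexists.
    + exact (fun y => adj_counit adj (proj1_sig y)).
    + intros x y f; exact (nt_nat (adj_counit adj) f).
  - split; apply nat_iso_pointwise.
    + intros [x Hx]; exact (Hunit x Hx).
    + intros [y Hy]; exact (Hcounit y Hy).
Qed.

(** Fullness lifts the counit at [L x] to some [h : R (L x) -> x].  It is a
    left inverse of the unit by faithfulness, and a right inverse because
    [η · h = R (L h) · η = R ε · η] is the identity.  So the counit is invertible
    at [L x], hence at every object, as all of them are of this form up to
    isomorphism. *)
Lemma restriction_counit_iso :
  restricts_to_equivalence L P Q ->
  forall y, Q y -> is_iso (adj_counit adj y).
Proof.
  intros [H E] y Hy.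
  destruct (equivalence_fully_faithful E) as [faithful full].
  destruct E as [K [_ [n [_ Hn]]]].
  pose proof (proj1 (nat_iso_pointwise n) Hn) as Hn'.
  set (x := K (exist Q y Hy)).
  assert (Hx : retract y (L (proj1_sig x))).
  { destruct (Hn' (exist Q y Hy)) as [g [_ Hg]].
    exists g, (n (exist Q y Hy)); exact Hg. }
  apply (iso_at_retract Hx); clear Hx.
  destruct x as [x Px]; cbn [proj1_sig].
  pose (z := exist P (R (L x)) (R_preserves (H x Px)) : full_subcategory P).
  destruct (full z (exist P x Px) (adj_counit adj (L x))) as [h Hh].
  cbn in h, Hh.
  assert (E1 : h ∘ eta x = idm x).
  { apply (faithful (exist P x Px) (exist P x Px)); cbn.
    rewrite fmap_comp, fmap_id, Hh; apply triangle_l. }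
  assert (E2 : eta x ∘ h = idm (R (L x))).
  { rewrite unit_natural, Hh; exact (triangle_r adj (L x)). }
  rewrite <- Hh.
  exact (fmap_iso L (iso_inverse E1 E2)).
Qed.

End RestrictedAdjunction.

(** * Isomorphisms of comonads and of comodules *)

Section Comonads.
Context {A : Category}.

Lemma comonad_iso_pointwise (H G : Comonad A) (m : ComonadMorphism H G) :
  is_comonad_iso m <-> forall a, is_iso (m a).
Proof.
  split.
  - intros [n [E E']] a; now exists (n a).
  - intros Hm; apply nat_iso_pointwise in Hm; destruct Hm as [n [E E']].
    unshelve eexists (@MkComonadMorphism _ G H n _ _).
    + intros a; rewrite <- cmm_eps with (c := m), <- comp_assoc, E'; apply comp_idr.
    + intros a.
      (* [m a] is an epimorphism, so it suffices to compare after composing with it. *)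
      rewrite <- (comp_idr (cm_delta H a ∘ n a)), <- (comp_idr (_ ∘ cm_delta G a)), <- (E' a).
      rewrite !(comp_assoc _ (m a)); f_equal.
      rewrite <- !comp_assoc, E, comp_idr, cmm_delta.
      rewrite <- comp_assoc, (comp_assoc (n (G a))), nt_nat.
      rewrite <- comp_assoc, (comp_assoc (n (H a))), E, comp_idl.
      now rewrite comp_assoc, <- fmap_comp, E, fmap_id, comp_idl.
    + split; trivial.
Qed.

Lemma forget_reflects_iso (G : Comonad A) (x y : comodule_category G) (f : hom x y) :
  is_iso (cmh_hom f) -> is_iso f.
Proof.
  intros [g [E E']].
  unshelve eexists (@MkComoduleHom _ G y x g _).
  - transitivity (fmap G (g ∘ cmh_hom f) ∘ cmd_theta x ∘ g).
    + now rewrite E, fmap_id, comp_idl.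
    + rewrite fmap_comp, <- (comp_assoc (fmap G g)), <- cmh_theta.
      now rewrite <- !comp_assoc, E', comp_idr.
  - split; now apply ComoduleHom_eq.
Qed.

End Comonads.

(** * The right adjoint on cofree comodules *)

Section CofreeCounit.
Context {A B : Category} (eqB : Equalisers B) (G : Comonad A)
  (F : Functor B A) (R : Functor A B) (adj : Adjunction F R)
  (Fbar : Functor B (comodule_category G)) (HF : forget G ○ Fbar = F).

Local Notation Rbar := (lift_right_adjoint adj HF eqB).
Local Notation epsbar := (adj_counit (lift_adjunction adj HF eqB)).
Local Notation iota b := (eq_nat HF b : hom (cmd_obj (Fbar b)) (F b)).
Local Notation t a := (lift_t adj HF a : hom (F (R a)) (G a)).
Local Notation eta b := (adj_unit adj b : hom b (R (F b))).
Local Notation delta a := (cm_delta G a : hom (G a) (G (G a))).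
Local Notation Rt a := (lift_Rt adj HF a).
Local Notation arr x := (eq_arr (lift_equaliser adj HF eqB x)).

(** This is the compatibility of [t] with comultiplications, transposed. *)
Lemma Rt_equalises (a : A) :
  fmap R (cmd_theta (cofree G a)) ∘ Rt a = Rt (G a) ∘ Rt a.
Proof.
  assert (Hd : delta a ∘ t a = fmap G (t a) ∘ t (F (R a)) ∘ fmap F (eta (R a)))
    by exact (cmm_delta (lift_t adj HF) a).
  change (fmap R (delta a) ∘ Rt a = Rt (G a) ∘ Rt a).
  unfold lift_Rt at 3.
  rewrite comp_assoc, lift_Rt_nat.
  unfold lift_Rt; rewrite comp_assoc, <- fmap_comp, Hd, !fmap_comp.
  rewrite <- !comp_assoc; do 2 f_equal.
  symmetry; exact (unit_natural adj (eta (R a))).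
Qed.

(** The comparison [R ≅ Rbar ∘ cofree] between the two right adjoints of [F]. *)
Definition cofree_factor (a : A) : hom (R a) (Rbar (cofree G a)) :=
  eq_fact (lift_equaliser adj HF eqB (cofree G a)) (Rt_equalises a).

Lemma cofree_factor_arr (a : A) : arr (cofree G a) ∘ cofree_factor a = Rt a.
Proof. apply eq_fact_arr. Qed.

(** [Rt a] is itself a split equaliser of the pair defining [Rbar (cofree a)], with
    splitting [R ε]: composing [R ε] with [Rt a] gives [R σ · η = id] since [t]
    preserves counits, and any map equalising the pair factors through [Rt a] by
    naturality of [Rt] and the counit law [G ε · δ = id]. *)
Lemma cofree_factor_iso (a : A) : is_iso (cofree_factor a).
Proof.
  assert (He : (cm_eps G a : hom (G a) a) ∘ t a = adj_counit adj a)
    by exact (cmm_eps (lift_t adj HF) a).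
  assert (Hr : fmap G (cm_eps G a : hom (G a) a) ∘ delta a = idm (G a))
    by exact (cm_counit_r G a).
  pose proof (lift_arr_eq adj HF eqB (cofree G a)) as Harr.
  change (fmap R (delta a) ∘ arr (cofree G a) = Rt (G a) ∘ arr (cofree G a)) in Harr.
  exists (fmap R (cm_eps G a : hom (G a) a) ∘ arr (cofree G a)); split.
  - rewrite <- comp_assoc, cofree_factor_arr; unfold lift_Rt.
    rewrite comp_assoc, <- fmap_comp, He; exact (triangle_r adj a).
  - apply eq_fact_uniq.
    rewrite comp_assoc, cofree_factor_arr.
    change (Rt a ∘ (fmap R (cm_eps G a : hom (G a) a) ∘ arr (cofree G a)) =
            arr (cofree G a) ∘ idm _).
    rewrite comp_assoc, lift_Rt_nat, <- comp_assoc.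
    rewrite <- Harr, comp_assoc, <- fmap_comp, Hr, fmap_id.
    exact (eq_trans (comp_idl _) (eq_sym (comp_idr _))).
Qed.

Lemma cofree_map_hom (a : A) :
  cmh_hom (lift_cofree_map adj HF a) = t a ∘ iota (R a).
Proof.
  rewrite lift_t_eq, <- comp_assoc.
  exact (f_equal (comp _) (lift_theta_iota adj HF (R a))).
Qed.

Lemma cofree_map_counit (a : A) :
  epsbar (cofree G a) ∘ fmap Fbar (cofree_factor a) = lift_cofree_map adj HF a.
Proof.
  apply ComoduleHom_eq; refine (eq_trans _ (eq_sym (cofree_map_hom a))).
  change ((adj_counit adj (G a) : hom (F (R (G a))) (G a)) ∘ fmap F (arr (cofree G a))
            ∘ iota (Rbar (cofree G a)) ∘ cmh_hom (fmap Fbar (cofree_factor a))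
          = t a ∘ iota (R a)).
  rewrite <- comp_assoc, iota_nat, comp_assoc; f_equal.
  rewrite <- comp_assoc, <- fmap_comp, cofree_factor_arr.
  apply lift_Rt_sigma.
Qed.

Lemma iota_iso (b : B) : is_iso (iota b).
Proof. exists (eq_nat (eq_sym HF) b); split; [apply (iotaV_iota adj) | apply (iota_iotaV adj)]. Qed.

Lemma cofree_map_iso_t (a : A) :
  is_iso (lift_cofree_map adj HF a) <-> is_iso (t a).
Proof.
  split; intros H.
  - apply (fmap_iso (forget G)) in H.
    change (is_iso (cmh_hom (lift_cofree_map adj HF a))) in H.
    rewrite cofree_map_hom in H.
    exact (iso_cancel_r (iota_iso (R a)) H).
  - apply forget_reflects_iso; rewrite cofree_map_hom.
    apply iso_comp; trivial; apply iota_iso.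
Qed.

Lemma cofree_map_iso_counit (a : A) :
  is_iso (lift_cofree_map adj HF a) <-> is_iso (epsbar (cofree G a)).
Proof.
  pose proof (fmap_iso Fbar (cofree_factor_iso a)) as Hk.
  rewrite <- cofree_map_counit; split; intros H.
  - exact (iso_cancel_r Hk H).
  - now apply iso_comp.
Qed.

(** * Injective objects under the lifted adjunction *)

(** [x] is a retract of [cofree (forget x)], so [Rbar x] is a retract of
    [Rbar (cofree (forget x)) ≅ R (forget x)]. *)
Lemma Rbar_injective (x : comodule_category G) :
  injective_for (forget G) x -> injective_for F (Rbar x).
Proof.
  intros Hx.
  apply (injective_retract (cofree_adjunction G)) in Hx.
  apply (fmap_retract Rbar) in Hx.
  refine (retract_injective (retract_trans Hx _) (right_adjoint_injective adj (a := cmd_obj x))).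
  exact (iso_retract_sym (cofree_factor_iso (cmd_obj x))).
Qed.

Lemma counit_iso_injective :
  (forall y, is_iso (epsbar (cofree G y))) ->
  forall x, injective_for (forget G) x -> is_iso (epsbar x).
Proof.
  intros H x Hx.
  exact (iso_at_retract (injective_retract (cofree_adjunction G) Hx) (H _)).
Qed.

(** [b] is a retract of [R (F b)], and [Fbar (R (F b)) ≅ cofree (F b)] under the
    hypothesis. *)
Lemma Fbar_injective :
  (forall y, is_iso (epsbar (cofree G y))) ->
  forall b, injective_for F b -> injective_for (forget G) (Fbar b).
Proof.
  intros H b Hb.
  apply (injective_retract adj) in Hb; apply (fmap_retract Fbar) in Hb.
  refine (retract_injective (retract_trans Hb _)
            (right_adjoint_injective (cofree_adjunction G) (a := F b))).
  exact (iso_retract (proj2 (cofree_map_iso_counit (F b)) (H (F b)))).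
Qed.

(** [b] is a retract of [R (F b) ≅ Rbar (cofree (F b))]; at the latter object the
    triangle identity exhibits the unit as inverse to the image of the counit. *)
Lemma unit_iso_injective :
  (forall y, is_iso (epsbar (cofree G y))) ->
  forall b, injective_for F b -> is_iso (adj_unit (lift_adjunction adj HF eqB) b).
Proof.
  intros H b Hb.
  refine (iso_at_retract _ (unit_iso_of_counit (H (F b)))).
  refine (retract_trans (injective_retract adj Hb) _).
  exact (iso_retract (cofree_factor_iso (F b))).
Qed.

End CofreeCounit.

(** * The equivalence *)

Theorem mainTheorem8 (A B : Category) (eqB : Equalisers B) (G : Comonad A)
  (F : Functor B A) (R : Functor A B) (adj : Adjunction F R)
  (Fbar : Functor B (comodule_category G)) (HF : forget G ○ Fbar = F) :
  let epsbar := adj_counit (lift_adjunction adj HF eqB) in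
  let a := is_comonad_iso (lift_t adj HF) in
  let b := is_nat_iso (lift_cofree_map adj HF) in
  let c := restricts_to_equivalence Fbar (injective_for F) (injective_for (forget G)) in
  let d := forall x : comodule_category G,
             injective_for (forget G) x -> is_iso (epsbar x) in
  let e := forall y : A, is_iso (epsbar (cofree G y)) in
  (a <-> b) /\ (b <-> c) /\ (c <-> d) /\ (d <-> e).
Proof.
  intros epsbar a b c d e.
  assert (ab : a <-> b).
  { unfold a, b; rewrite comonad_iso_pointwise, nat_iso_pointwise.
    split; intros H y; apply cofree_map_iso_t, H. }
  assert (be : b <-> e).
  { unfold b, e; rewrite nat_iso_pointwise.
    split; intros H y; apply (cofree_map_iso_counit eqB adj HF y), H. }
  assert (cd : c -> d).
  { exact (restriction_counit_iso (lift_adjunction adj HF eqB)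
             (Rbar_injective (adj := adj) (HF := HF) (eqB := eqB))). }
  assert (de : d -> e).
  { intros H y; apply H, (right_adjoint_injective (cofree_adjunction G)). }
  assert (ec : e -> c).
  { intros H.
    exact (restriction_equivalence
             (Rbar_injective (adj := adj) (HF := HF) (eqB := eqB))
             (Fbar_injective H) (unit_iso_injective H) (counit_iso_injective H)). }
  tauto.
Qed.
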